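(* Let $\mathcal{D}$ be a distribution on $\mathbb{R}^d$, $f$ a linear threshold function on $\mathbb{R}^d$, $q\ge2$ and $k\in\{1,\dots,q-1\}$, and let $\mathcal{M}$ be a collection of $m$ bags sampled i.i.d. from $\mathrm{Ex}(f,\mathcal{D},q,k)$. There is an absolute constant $C_0>0$ such that for any $\varepsilon<1/(4q)$ and $\delta>0$, if $m\ge C_0d(\log q+\log(1/\delta))/\varepsilon^2$, then with probability at least $1-\delta$ over $\mathcal{M}$, every linear threshold function $h$ on $\mathbb{R}^d$ with $\mathrm{BagErr}_{\mathrm{sample}}(h,\mathcal{M})\le\varepsilon$ satisfies: (i) if $k\neq q/2$, $\Pr_{\mathbf{x}\sim\mathcal{D}}[f(\mathbf{x})\neq h(\mathbf{x})]\le4\varepsilon$; and (ii) if $k=q/2$, $\Pr_{\mathbf{x}\sim\mathcal{D}}[f(\mathbf{x})\neq h(\mathbf{x})]\le4\varepsilon$ or $\Pr_{\mathbf{x}\sim\mathcal{D}}[f(\mathbf{x})\neq1-h(\mathbf{x})]\le4\varepsilon$.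
   Context: A linear threshold function (LTF) is $\mathbf{x}\mapsto\mathrm{pos}(\mathbf{r}^{\mathsf T}\mathbf{x}+c)$ with $\mathrm{pos}(a)=1$ if $a>0$ and $0$ otherwise. The bag oracle $\mathrm{Ex}(f,\mathcal{D},q,k)$ returns a bag $B=\{\mathbf{x}^{(1)},\dots,\mathbf{x}^{(q)}\}$ of independent points with $\mathbf{x}^{(i)}\sim\mathcal{D}_{f,1}$ for $i\le k$ and $\mathbf{x}^{(i)}\sim\mathcal{D}_{f,0}$ for $i>k$, where $\mathcal{D}_{f,a}$ is $\mathcal{D}$ conditioned on $f(\mathbf{x})=a$ (both events assumed to have positive probability). For a hypothesis $h$ and a collection $\mathcal{M}$ of $m$ bags, $\mathrm{BagErr}_{\mathrm{sample}}(h,\mathcal{M}):=|\{B\in\mathcal{M}:\mathrm{Avg}\{h(\mathbf{x}):\mathbf{x}\in B\}\neq k/q\}|/m$. *)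

(* Defs.v *)
From HB Require Import structures.
From mathcomp Require Import all_boot all_order all_algebra.
From mathcomp Require Import all_classical all_reals all_analysis.
From mathcomp Require Import Rstruct Rstruct_topology.
From Stdlib Require Import Rdefinitions.

Set Implicit Arguments.
Unset Strict Implicit.
Unset Printing Implicit Defensive.

Import Order.TTheory GRing.Theory Num.Theory.
Local Open Scope classical_set_scope.
Local Open Scope ring_scope.

Notation R := Rdefinitions.R.

Definition Rd (d : nat) := g_sigma_algebraType (@open 'rV[R]_d).

Definition pos (a : R) : R := if 0 < a then 1 else 0.

Definition ltf (d : nat) (r : 'rV[R]_d) (c : R) (x : Rd d) : R :=
  pos ((\sum_(i < d) r ord0 i * (x : 'rV[R]_d) ord0 i) + c).

Definition is_ltf (d : nat) (h : Rd d -> R) : Prop :=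
  exists (r : 'rV[R]_d) (c : R), forall x, h x = ltf r c x.

Definition cond_prob (d : nat) (D : probability (Rd d) R) (f : Rd d -> R)
  (a : R) (A : set (Rd d)) : R :=
  fine (D (A `&` [set x | f x = a])) / fine (D [set x | f x = a]).

Definition bag_avg (d q : nat) (h : Rd d -> R) (B : 'I_q -> Rd d) : R :=
  (\sum_(j < q) h (B j)) / q%:R.

Definition bag_err (d q k m : nat) (h : Rd d -> R)
  (M : 'I_m -> 'I_q -> Rd d) : R :=
  #|[set i : 'I_m | bag_avg h (M i) != k%:R / q%:R]|%:R / m%:R.

Definition disagree (d : nat) (D : probability (Rd d) R) (g1 g2 : Rd d -> R) : R :=
  fine (D [set x | g1 x <> g2 x]).

Definition mutually_independent {dO} {O : measurableType dO} (P : probability O R)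
  (d m q : nat) (X : 'I_m -> 'I_q -> O -> Rd d) : Prop :=
  forall (J : {set 'I_m * 'I_q}) (A : 'I_m -> 'I_q -> set (Rd d)),
    (forall i j, measurable (A i j)) ->
    fine (P [set w | forall p, p \in J -> A p.1 p.2 (X p.1 p.2 w)]) =
    \prod_(p in J) fine (P (X p.1 p.2 @^-1` A p.1 p.2)).

(* M = (X i j)_{i,j} is a collection of m bags sampled i.i.d. from
   Ex(f, D, q, k): all points independent, point j of every bag has law
   D_{f,1} if j < k (i.e. j+1 <= k) and D_{f,0} otherwise. *)
Definition bags_from_oracle {dO} {O : measurableType dO} (P : probability O R)
  (d : nat) (D : probability (Rd d) R) (f : Rd d -> R) (q k m : nat)
  (X : 'I_m -> 'I_q -> O -> Rd d) : Prop :=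
  (forall i j, measurable_fun setT (X i j)) /\
  mutually_independent P X /\
  (forall i j (A : set (Rd d)), measurable A ->
     fine (P (X i j @^-1` A)) =
     cond_prob D f (if ltn (nat_of_ord j) k then 1 else 0) A).

(* Main.v *)
Require Import Defs.
From HB Require Import structures.
From mathcomp Require Import all_boot all_order all_algebra.
From mathcomp Require Import all_classical all_reals all_analysis.
From mathcomp Require Import ring lra zify.

Set Implicit Arguments.
Unset Strict Implicit.
Unset Printing Implicit Defensive.

Import Order.TTheory GRing.Theory Num.Theory.
Import numFieldNormedType.Exports.
Local Open Scope ring_scope.

(* Let [s1], [s0] be the probabilities that [h] outputs 1 on a positive,
   respectively negative, point.  A bag is misjudged with probability at most
   [4 eps < 1/2] only if each of [s1], [s0] is within [4 eps] of 0 or 1 and the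
   most likely label vector of a bag has exactly [k] ones: this forces [h] to be
   [4 eps]-close to [f], or to [1 - f] when [k = q/2].

   It remains to see that, outside an event of probability [delta], no [h] whose
   true bag error exceeds [4 eps] has sample bag error at most [eps].  This is a
   relative deviation bound: symmetrization with a ghost sample, then random
   swaps, give a failure probability [2 G exp (- 5 eps m / 32)], where [G] bounds
   the number of labelings of [2 m q] points by halfspaces.  Cover's recursion
   gives [G <= (1+t)^(2mq) / t^(d+1)] for every [t] in (0,1]; with
   [t = eps / (32 q)] no logarithm of [m] appears.

   Halfspaces with rational coefficients approximate every halfspace pointwise,
   so only countably many hypotheses matter.  For the first [N] of them a point
   matters only through its pattern of [N] labels; the sample then takes
   finitely many values, and the whole symmetrization, ghost sample included,
   is a computation with finite sums. *)

(** * Labelings by halfspaces *)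

Section Labelings.
Variable (K : realFieldType) (D : nat).
Implicit Types (v : 'rV[K]_D) (y : 'cV[K]_D) (U : 'M[K]_D).

Definition positive_on v y : bool := 0 < (v *m y) ord0 ord0.

(** The weight [- b] is nonnegative and [a] is positive, so [- b v1 + a v2] keeps every sign on
    which [v1] and [v2] agree; the two contributions cancel at [y]. *)
Lemma zero_crossing v1 v2 y (s : seq 'cV[K]_D) U :
  (v1 <= U)%MS -> (v2 <= U)%MS -> positive_on v1 y -> ~~ positive_on v2 y ->
  map (positive_on v1) s = map (positive_on v2) s ->
  exists2 v, (v <= U :&: kermx y)%MS &
    map (positive_on v) s = map (positive_on v1) s.
Proof.
rewrite /positive_on -leNgt => v1U v2U y1 y2 e12.
set a := (v1 *m y) ord0 ord0 in y1; set b := (v2 *m y) ord0 ord0 in y2.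
have mulE c1 c2 (z : 'cV_D) : ((c1 *: v1 + c2 *: v2) *m z) ord0 ord0 =
    c1 * (v1 *m z) ord0 ord0 + c2 * (v2 *m z) ord0 ord0.
  by rewrite mulmxDl -!scalemxAl !mxE.
exists ((- b) *: v1 + a *: v2).
  rewrite sub_capmx addmx_sub ?scalemx_sub //=; apply/sub_kermxP.
  apply/matrixP => i j; rewrite !ord1 mulE -/a -/b mxE; ring.
apply/eq_in_map => z zs; rewrite mulE.
have /(_ z zs) := iffRL (eq_in_map _ _ _) e12.
case: (ltP 0 ((v1 *m z) _ _)) => h1; case: (ltP 0 ((v2 *m z) _ _)) => h2 // _.
  by nra.
by apply/negbTE; rewrite -leNgt; nra.
Qed.

(* The lists whose head can be either bit come from vectors of [U] orthogonal
   to [y], so the count obeys [N n r <= N (n-1) r + N (n-1) (r-1)]. *)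
Lemma size_labelings (t : K) (s : seq 'cV[K]_D) U (L : seq (seq bool)) :
  0 < t <= 1 -> uniq L ->
  (forall l, l \in L ->
     exists2 v, (v <= U)%MS & l = map (positive_on v) s) ->
  (size L)%:R * t ^+ \rank U <= (1 + t) ^+ size s.
Proof.
move=> /andP[t0 t1]; elim: s U L => [|y s IH] U L uL HL.
  have : (size L <= 1)%N.
    apply: (@uniq_leq_size _ L [:: [::]]) => // l /HL[v _ ->]; by rewrite inE.
  rewrite /= expr0 -(ler_nat K) => h; rewrite -[leRHS]mulr1.
  by apply: ler_pM => //; [rewrite exprn_ge0// ltW|rewrite exprn_ile1// ltW].
pose T := [seq behead l | l <- L & head true l].
pose F := [seq behead l | l <- L & ~~ head true l].
have sL : (size L = size T + size F)%N.
  by rewrite !size_map -(count_predC (head true) L) !size_filter.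
have HC l : l \in L -> l = head true l :: behead l.
  by move=> /HL[v _ ->].
have uT : uniq T.
  rewrite map_inj_in_uniq ?filter_uniq// => l l'.
  rewrite !mem_filter => /andP[h /HC ->] /andP[h' /HC ->] /= ->.
  by rewrite h h'.
have uF : uniq F.
  rewrite map_inj_in_uniq ?filter_uniq// => l l'.
  rewrite !mem_filter => /andP[h /HC ->] /andP[h' /HC ->] /= ->.
  by rewrite (negbTE h) (negbTE h').
have HT l : l \in T -> exists2 v, (v <= U)%MS & 
    positive_on v y /\ l = map (positive_on v) s.
  move=> /mapP[l' + ->]; rewrite mem_filter => /andP[hh /HL[v vU lE]].
  by exists v => //; move: hh; rewrite lE.
have HF l : l \in F -> exists2 v, (v <= U)%MS & 
    ~~ positive_on v y /\ l = map (positive_on v) s.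
  move=> /mapP[l' + ->]; rewrite mem_filter => /andP[hh /HL[v vU lE]].
  by exists v => //; move: hh; rewrite lE.
(* [A] and [B] enumerate the union and the intersection of the two sets of tails; the tails in [B]
   are those that extend by both bits. *)
pose A := T ++ [seq l <- F | l \notin T].
pose B := [seq l <- F | l \in T].
have sAB : (size L = size A + size B)%N.
  rewrite sL size_cat -addnA; congr addn.
  by rewrite -(count_predC (mem T) F) !size_filter addnC.
have hA : (size A)%:R * t ^+ \rank U <= (1 + t) ^+ size s.
  apply: IH.
    rewrite cat_uniq uT filter_uniq// andbT.
    by apply/hasPn => l; rewrite mem_filter => /andP[].
  move=> l; rewrite mem_cat => /orP[/HT[v vU [_ ->]]|]; first by exists v.
  by rewrite mem_filter => /andP[_ /HF[v vU [_ ->]]]; exists v.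
have hB : (size B)%:R * t ^+ \rank U <= t * (1 + t) ^+ size s.
  have [B0|[b bB]] : size B = 0 \/ exists b, b \in B.
    by case: (B) => [|b B']; [left|right; exists b; rewrite mem_head].
    by rewrite B0 mul0r mulr_ge0 ?exprn_ge0 ?addr_ge0// ltW.
  (* A vector of [U] positive at [y] lies outside the kernel, so the rank drops; this gains the
     factor [t] that closes the recursion, as [(1+t)^n + t (1+t)^n = (1+t)^(n+1)]. *)
  have ltr : (\rank (U :&: kermx y) < \rank U)%N.
    move: bB; rewrite mem_filter => /andP[/HT[v vU [vy _]] _].
    apply: rank_ltmx; rewrite ltmxE capmxSl /=; apply/negP => /(submx_trans vU).
    rewrite sub_capmx => /andP[_ /sub_kermxP vy0].
    by move: vy; rewrite /positive_on vy0 mxE ltxx.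
  have := IH (U :&: kermx y)%MS B (filter_uniq _ uF).
  have HB l : l \in B -> exists2 v, (v <= U :&: kermx y)%MS &
      l = map (positive_on v) s.
    rewrite mem_filter => /andP[/HT[v1 v1U [v1y ->]] /HF[v2 v2U [v2y e12]]].
    have [v vU <-] := zero_crossing v1U v2U v1y v2y e12.
    by exists v.
  move=> /(_ HB) h.
  rewrite -(subnKC ltr) addSn exprS mulrCA ler_pM2l// exprD.
  apply: le_trans h; rewrite mulrA ler_piMr//.
    by rewrite mulr_ge0// exprn_ge0// ltW.
  by rewrite exprn_ile1// ltW.
rewrite sAB natrD mulrDl /= exprS mulrDl mul1r.
exact: lerD.
Qed.

Lemma card_labelings (t : K) (I J : finType) (y : I -> 'cV[K]_D)
    (v : J -> 'rV[K]_D) (Q : {set J}) :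
  0 < t <= 1 ->
  #|[set [ffun i => positive_on (v j) (y i)] | j in Q]|%:R * t ^+ D
    <= (1 + t) ^+ #|I|.
Proof.
move=> t01; set S := [set _ | j in Q].
pose L := [seq [seq f i | i <- enum I] | f : {ffun I -> bool} <- enum S].
have := @size_labelings t [seq y i | i <- enum I] 1%:M L t01.
rewrite mxrank1 /L 2!size_map -!cardE; apply.
  rewrite map_inj_uniq ?enum_uniq// => f g /eq_in_map fg; apply/ffunP => i.
  by apply: fg; rewrite mem_enum.
move=> l /mapP[f + ->]; rewrite mem_enum => /imsetP[j _ ->].
exists (v j); first exact: submx1.
by rewrite -map_comp; apply: eq_map => i; rewrite ffunE.
Qed.
End Labelings.

(** * Sums of independent bits *)

Section BernoulliSums.
Variable K : realFieldType.
Implicit Types (p : {poly K}) (a : K).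

(** Probability generating function of a bit equal to 1 with probability [a]: the coefficients of a
    product give the law of the sum of independent bits. *)
Definition bernoulli_poly a : {poly K} := (1 - a)%:P + a *: 'X.

Lemma coef_mul_bernoulli_poly a p k :
  (bernoulli_poly a * p)`_k =
  (1 - a) * p`_k + (if k is k'.+1 then a * p`_k' else 0).
Proof.
rewrite /bernoulli_poly mulrDl coefD mul_polyC coefZ -scalerAl coefZ coefXM.
by case: k => [|k] //=; rewrite mulr0.
Qed.

(** Bounding only pairs of coefficients suffices below and is stable under multiplication by a
    Bernoulli factor. *)
Definition subprobability p :=
  (forall i, 0 <= p`_i) /\ (forall i j, i != j -> p`_i + p`_j <= 1).

Lemma subprobability_le1 p i : subprobability p -> p`_i <= 1.
Proof.
by case=> p0 p1; apply: le_trans (p1 i i.+1 _); rewrite ?lerDl// neq_ltn ltnSn.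
Qed.

Lemma subprobability_prod (I : Type) (r : seq I) (Q : pred I) (a : I -> K) :
  (forall i, 0 <= a i <= 1) ->
  subprobability (\prod_(i <- r | Q i) bernoulli_poly (a i)).
Proof.
move=> a01; apply: big_rec => [|i p _ Sp].
  split=> [i|i j ij]; rewrite !coef1 ?ler0n// -natrD lern1.
  by case: i j ij => [|i] [|j].
have /andP[a0 a1] := a01 i; have b0 : 0 <= 1 - a i by rewrite subr_ge0.
have p1 k := @subprobability_le1 p k Sp; have [p0 pp] := Sp.
split=> [k|k l kl]; rewrite !coef_mul_bernoulli_poly.
  by case: k => [|k]; rewrite addr_ge0// mulr_ge0.
have pkl := pp _ _ kl; case: k l kl pkl => [|k] [|l] //= kl pkl.
- by have := p1 l; nra.
- by have := p1 k; nra.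
- by have := pp k l kl; nra.
Qed.

(** Isolating bit [i] writes the coefficient as [(1 - a i) p_k + a i p_(k-1)], where
    [p_k + p_(k-1) <= 1]. Hence a coefficient close to 1 forces every [a i] close to 0 or 1. *)
Lemma coef_bernoulli_prod_max (I : finType) (a : I -> K) (i : I) k :
  (forall i, 0 <= a i <= 1) ->
  (\prod_i bernoulli_poly (a i))`_k <= Num.max (a i) (1 - a i).
Proof.
move=> a01; rewrite (bigD1 i)//= coef_mul_bernoulli_poly.
have Sp := subprobability_prod (index_enum I) (fun j => j != i) a01.
set p := \prod_(_ | _) _ in Sp *; have p1 l := @subprobability_le1 p l Sp.
have [p0 pp] := Sp; have /andP[a0 a1] := a01 i.
have [m1 m2] : a i <= Num.max (a i) (1 - a i) /\ 1 - a i <= Num.max (a i) (1 - a i).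
  by rewrite !le_max !lexx orbT.
set m := Num.max _ _ in m1 m2 *.
case: k => [|k].
  by have := p1 0; have := p0 0; nra.
have kk : k.+1 != k by rewrite neq_ltn ltnSn orbT.
have := pp _ _ kk; have := p0 k; have := p0 k.+1; nra.
Qed.

(* [\sum_i b i] is the value at the most likely outcome; every other value of
   the sum of independent bits has probability at most 1/2. *)
Lemma coef_bernoulli_prod_half (I : finType) (a : I -> K) (b : I -> bool) k :
  (forall i, 0 <= a i <= 1) -> (forall i, if b i then 1/2 <= a i else a i <= 1/2) ->
  k != (\sum_i b i)%N -> (\prod_i bernoulli_poly (a i))`_k <= 1/2.
Proof.
move=> a01 ab.
elim: (index_enum I) k => [|i r IH] k.
  by rewrite !big_nil coef1 => /negbTE ->; rewrite /=; lra.
rewrite !big_cons coef_mul_bernoulli_poly.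
have [p0 pp] := subprobability_prod r predT a01.
set p := \prod_(_ <- r) _ in IH p0 pp *; set c := (\sum_(_ <- r) _)%N in IH *.
have /andP[a0 a1] := a01 i; have := ab i; case: (b i) => /= ai.
  case: k => [_|k].
    by have := p0 0; have := subprobability_le1 0 (conj p0 pp); nra.
  rewrite add1n eqSS => kc; have hk := IH _ kc.
  (* If [k.+1] is the most likely value [c], the coefficient is [(1-a)(p_(k+1) + p_k) + (2a-1) p_k],
     at most [(1-a) + (2a-1)/2 = 1/2]; otherwise both [p_(k+1)] and [p_k] are at most 1/2. *)
  have [e|/IH hk1] := eqVneq k.+1 c; last by nra.
  by have := pp k.+1 k; rewrite neq_ltn ltnSn orbT => /(_ isT); nra.
rewrite add0n => kc; have hk := IH _ kc.
case: k kc hk => [|k] kc hk; first by have := p0 0; nra.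
have [e|/IH hk1] := eqVneq k c; last by nra.
by have := pp k.+1 k; rewrite neq_ltn ltnSn orbT => /(_ isT); nra.
Qed.

Lemma coef_bernoulli_prod (I : finType) (a : I -> K) k :
  (\prod_i bernoulli_poly (a i))`_k =
  \sum_(b : {ffun I -> bool} | (\sum_i b i)%N == k)
     \prod_i (if b i then a i else 1 - a i).
Proof.
have E i : bernoulli_poly (a i) =
    \sum_(c : bool) (if c then a i else 1 - a i) *: 'X^c.
  by rewrite big_bool /= expr1 expr0 addrC alg_polyC.
rewrite (eq_bigr _ (fun i _ => E i)) bigA_distr_bigA coef_sum [RHS]big_mkcond.
apply: eq_bigr => b _; rewrite scaler_prod.
by rewrite prodrXr coefZ coefXn eq_sym; case: eqP => _; rewrite ?mulr1 ?mulr0.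
Qed.

(** The image of a product law under a coordinatewise map is the product of the images: group the
    [z] by their bits and sum each fibre coordinate by coordinate. *)
Lemma sum_prod_bits (I T : finType) (mu : I -> T -> K) (g : T -> bool)
    (Q : pred {ffun I -> bool}) :
  \sum_(z : {ffun I -> T} | Q [ffun i => g (z i)]) \prod_i mu i (z i) =
  \sum_(b | Q b) \prod_i \sum_(x | g x == b i) mu i x.
Proof.
rewrite (partition_big (fun z : {ffun I -> T} => [ffun i => g (z i)]) Q)//=.
apply: eq_bigr => b Qb; rewrite bigA_distr_big_dep; apply: eq_bigl => z.
apply/andP/familyP => [[_ /eqP <-] i|zb]; first by rewrite ffunE; apply: eqxx.
have -> : [ffun i => g (z i)] = b.
  by apply/ffunP => i; rewrite ffunE; apply/eqP/(zb i).
by rewrite eqxx.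
Qed.
End BernoulliSums.

(** Since [1 <= k <= q-1], positions 0 and [q-1] carry [s1] and [s0], so both are within [e] of 0 or
    1; comparing [k] with the most likely sum then selects the admissible roundings. *)
Lemma bernoulli_bag_concentration (K : realFieldType) (s1 s0 e : K) (q k : nat) :
  (1 <= k <= q.-1)%N -> 0 <= s1 <= 1 -> 0 <= s0 <= 1 -> e < 1/2 ->
  1 - e <= (\prod_(j < q) bernoulli_poly (if (j < k)%N then s1 else s0))`_k ->
  (1 - s1 <= e /\ s0 <= e) \/ [/\ (k + k = q)%N, s1 <= e & 1 - s0 <= e].
Proof.
move=> /andP[k1 kq] s1P s0P e2 pk.
have a01 (j : 'I_q) : 0 <= (if (j < k)%N then s1 else s0) <= 1 by case: ifP.
have [q0 hq kq'] : [/\ 0 < q, q.-1 < q & k < q]%N by split; clear -k1 kq; lia.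
have := le_trans pk (coef_bernoulli_prod_max (Ordinal q0) k a01).
have := le_trans pk (coef_bernoulli_prod_max (Ordinal hq) k a01).
rewrite /= k1 ltnNge kq /= !le_max !lerD2l => m0 m1.
have half (b1 b0 : bool) : (if b1 then 1/2 <= s1 else s1 <= 1/2) ->
    (if b0 then 1/2 <= s0 else s0 <= 1/2) ->
    k = (k * b1 + (q - k) * b0)%N.
  move=> hb1 hb0; apply/eqP/contraT => kne.
  have : (\prod_(j < q) bernoulli_poly (if (j < k)%N then s1 else s0))`_k <= 1/2.
    apply: (@coef_bernoulli_prod_half _ _ _
      (fun j : 'I_q => if (j < k)%N then b1 else b0)) => //.
      by move=> j; case: (j < k)%N.
    suff -> : (\sum_(j < q) (if (j < k)%N then b1 else b0) =
        k * b1 + (q - k) * b0)%N by [].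
    rewrite (eq_bigr (fun j : 'I_q => (if (j < k)%N then b1 : nat else b0 : nat)));
      last by move=> j _; case: ifP.
    rewrite -(big_mkord xpredT (fun j => if (j < k)%N then b1 : nat else b0 : nat)).
    rewrite (@big_cat_nat _ _ _ k) ?(ltnW kq')//=.
    congr addn.
      rewrite (eq_big_nat _ _ (F2 := fun=> b1 : nat)); last by move=> j /andP[_ ->].
      by rewrite sum_nat_const_nat subn0.
    rewrite (eq_big_nat _ _ (F2 := fun=> b0 : nat)); last first.
      by move=> j /andP[kj _]; rewrite ltnNge kj.
    by rewrite sum_nat_const_nat.
  lra.
(* The roundings (1,1) and (0,0) would give [k = q] and [k = 0]; (1,0) is always consistent, and
   (0,1) requires [k = q - k]. *)
have [h1|h1] := orP m1; have [h0|h0] := orP m0.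
- have /= : k = (k * true + (q - k) * true)%N by apply: half; lra.
  by clear -k1 kq'; lia.
- by left; split; lra.
- right; have /= : k = (k * false + (q - k) * true)%N by apply: half; lra.
  by move=> kE; split; [clear -kE kq'; lia|lra|lra].
- have /= : k = (k * false + (q - k) * false)%N by apply: half; lra.
  by clear -k1 kq'; lia.
Qed.

(** * Symmetrization over a finite space *)

Section Symmetrization.
Variables (K : realType) (Z : finType) (nu : Z -> K) (m : nat).
Hypothesis nu_ge0 : forall z, 0 <= nu z.
Hypothesis nu_sum1 : \sum_z nu z = 1.
Implicit Types (z : {ffun 'I_m -> Z}) (E : pred Z).

Definition sample_weight z : K := \prod_i nu (z i).

Lemma sample_weight_ge0 z : 0 <= sample_weight z.
Proof. exact: prodr_ge0. Qed.

Lemma sum_sample_weight : \sum_z sample_weight z = 1.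
Proof. by rewrite -(bigA_distr_bigA (fun=> nu)) nu_sum1 big1. Qed.

Definition hits E z : nat := (\sum_i E (z i))%N.

(* Chernoff's method at the parameter 1/2. *)
Lemma few_hits_unlikely E (e : K) :
  3 <= e * m%:R -> 4 * e <= \sum_(z | E z) nu z ->
  \sum_(z | (hits E z)%:R <= 2 * (e * m%:R)) sample_weight z <= 1 / 2.
Proof.
move=> em3 Ee; set M := e * m%:R in em3 *.
have expN : expR (- (1 / 2)) <= 2 / 3 :> K.
  have e1 : expR (- (1 / 2)) * expR (1 / 2) = 1 :> K by rewrite -expRD addNr expR0.
  have e2 := expR_ge1Dx (1 / 2 : K); have e3 := expR_gt0 (- (1 / 2) : K).
  by nra.
have step z : (hits E z)%:R <= 2 * M ->
    sample_weight z <= expR M * \prod_i (nu (z i) * expR (- (1 / 2) * (E (z i))%:R)).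
  move=> hz; rewrite big_split /= -expR_sum -mulr_sumr -natr_sum mulrCA -expRD.
  rewrite ler_peMr ?sample_weight_ge0// -[leLHS]expR0 ler_expR.
  by move: hz; rewrite /hits; lra.
apply: le_trans (ler_sum _ step) _.
rewrite -mulr_sumr.
apply: (@le_trans _ _ (expR M * \sum_(z : {ffun _ -> Z})
    \prod_i (nu (z i) * expR (- (1 / 2) * (E (z i))%:R)))).
  rewrite ler_pM2l ?expR_gt0// [leLHS]big_mkcond; apply: ler_sum => z _.
  by case: ifP => // _; apply: prodr_ge0 => i _; rewrite mulr_ge0// expR_ge0.
rewrite -(bigA_distr_bigA (fun=> fun x => nu x * expR (- (1 / 2) * (E x)%:R))).
rewrite prodr_const card_ord.
have b0 : 0 <= \sum_x nu x * expR (- (1 / 2) * (E x)%:R).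
  by apply: sumr_ge0 => x _; rewrite mulr_ge0// expR_ge0.
(* The mean of [exp (- E / 2)] is at most [1 - A / 3], with [A >= 4 e] the weight of [E]. *)
have bE : \sum_x nu x * expR (- (1 / 2) * (E x)%:R) <= expR (- (4 / 3) * e).
  apply: le_trans (expR_ge1Dx _); rewrite (bigID E)/=.
  under eq_bigr => x Ex do rewrite Ex mulr1.
  under [X in _ + X]eq_bigr => x Ex do rewrite (negbTE Ex) mulr0 expR0 mulr1.
  rewrite -mulr_suml; move: nu_sum1 Ee; rewrite (bigID E)/=.
  set A := \sum_(_ | _) _; set B := \sum_(_ | _) _ => AB Ae.
  have A0 : 0 <= A by apply: sumr_ge0.
  by nra.
apply: (@le_trans _ _ (expR M * expR (- (4 / 3) * e) ^+ m)).
  by rewrite ler_pM2l ?expR_gt0// lerXn2r ?nnegrE ?expR_ge0.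
rewrite -expRM_natl -expRD.
(* The exponent is [M - 4 M / 3 = - M / 3], at most -1 because [M >= 3]. *)
apply: (@le_trans _ _ (expR (- 1))).
  by rewrite ler_expR; move: em3; rewrite /M; nra.
rewrite expRN div1r lef_pV2 ?posrE ?expR_gt0//.
by apply: le_trans (expR_ge1Dx _).
Qed.

Definition swap (s : {ffun 'I_m -> bool})
    (u : {ffun 'I_m -> Z} * {ffun 'I_m -> Z}) :=
  ([ffun i => if s i then u.2 i else u.1 i],
   [ffun i => if s i then u.1 i else u.2 i]).

Lemma swapK s : involutive (swap s).
Proof.
move=> [z z']; congr pair; apply/ffunP => i; rewrite !ffunE /=;
by case: (s i).
Qed.

Lemma sample_weight_swap s u :
  sample_weight (swap s u).1 * sample_weight (swap s u).2 =
  sample_weight u.1 * sample_weight u.2.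
Proof.
rewrite -!big_split; apply: eq_bigr => i _ /=; rewrite !ffunE.
by case: (s i) => //; rewrite mulrC.
Qed.

Definition swap_weight (s : bool) (t : bool * bool) : K :=
  let t' := if s then (t.2, t.1) else t in
  (2 / 3) ^+ t'.1 * (4 / 3) ^+ t'.2.

(* The weights 2/3 and 4/3 make the average over the two orders of any pair of
   bits at most 1, while [(4/3)^2 * (2/3) > 1]. *)
Lemma sum_swap_weight (t : {ffun 'I_m -> bool * bool}) :
  \sum_(s : {ffun 'I_m -> bool}) \prod_i swap_weight (s i) (t i) <= 2 ^+ m.
Proof.
rewrite -(bigA_distr_bigA (fun i s => swap_weight s (t i))).
rewrite -[X in _ <= _ ^+ X]card_ord -prodr_const; apply: ler_prod => i _.
rewrite big_bool /swap_weight; case: (t i) => [[] []] /=;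
  rewrite ?expr0 ?expr1; lra.
Qed.

(** The logarithm of the right side is at least [M (ln (2/3) + 2 ln (4/3)) = M ln (32/27)], and
    [ln (32/27) = - ln (1 - 5/32) >= 5/32]. *)
Lemma skewed_swap_weight (M : K) (a b : nat) :
  0 <= M -> a%:R <= M -> 2 * M <= b%:R ->
  expR (5 / 32 * M) <= (2 / 3) ^+ a * (4 / 3) ^+ b :> K.
Proof.
move=> M0 aM bM.
have x0 : 0 < 2 / 3 :> K by lra.
have y0 : 0 < 4 / 3 :> K by lra.
rewrite -[X in _ <= X ^+ _ * _]lnK ?posrE// -[X in _ <= _ * X ^+ _]lnK ?posrE//.
rewrite -!expRM_natl -expRD ler_expR.
have y1 : 0 <= ln (4 / 3 : K) by rewrite ln_ge0//; lra.
have xy : ln (2 / 3 : K) + 2 * ln (4 / 3) >= 5 / 32.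
  have e : ln (2 / 3 : K) + 2 * ln (4 / 3) = - ln (1 + - (5 / 32)).
    rewrite (_ : 2 * ln (4 / 3) = ln (4 / 3) + ln (4 / 3)); last lra.
    rewrite -!lnM ?posrE ?mulr_gt0// -lnV ?posrE; last lra.
    by congr ln; rewrite (_ : 1 + - (5 / 32) = 27 / 32) ?invf_div; lra.
  have := @le_ln1Dx K (- (5 / 32)); lra.
have x1 : ln (2 / 3 : K) <= 0 by rewrite ln_le0//; lra.
by nra.
Qed.

(** All that the swapped counts depend on: hypotheses with equal traces are indistinguishable, so
    the union bound runs over distinct traces. *)
Definition bit_trace (N : nat) (E : 'I_N -> pred Z)
    (u : {ffun 'I_m -> Z} * {ffun 'I_m -> Z}) (n : 'I_N) :
    {ffun 'I_m -> bool * bool} :=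
  [ffun i => (E n (u.1 i), E n (u.2 i))].

Lemma uniform_hits_bound (N : nat) (E : 'I_N -> pred Z) (Q : {set 'I_N})
    (e G : K) :
  3 <= e * m%:R ->
  (forall n, n \in Q -> 4 * e <= \sum_(z | E n z) nu z) ->
  (forall u : {ffun 'I_m -> Z} * {ffun 'I_m -> Z},
     (forall i, nu (u.1 i) != 0) -> (forall i, nu (u.2 i) != 0) ->
     #|[set bit_trace E u n | n in Q]|%:R <= G) ->
  \sum_(z | [exists n in Q, (hits (E n) z)%:R <= e * m%:R]) sample_weight z
    <= 2 * G * expR (- (5 / 32) * (e * m%:R)).
Proof.
move=> em3 QE HG; set M := e * m%:R in em3 *.
pose A (u : {ffun 'I_m -> Z} * {ffun 'I_m -> Z}) := [exists n in Q,
  ((hits (E n) u.1)%:R <= M) && (2 * M <= (hits (E n) u.2)%:R)].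
pose W u := sample_weight u.1 * sample_weight u.2.
have W0 u : 0 <= W u by rewrite mulr_ge0 ?sample_weight_ge0.
(* Once [z] fixes a culprit [n], an independent ghost sample has more than [2 M] hits of [E n] with
   probability at least 1/2, which costs the factor 2. *)
have ghost : \sum_(z | [exists n in Q, (hits (E n) z)%:R <= M]) sample_weight z
    <= 2 * \sum_(u | A u) W u.
  rewrite big_mkcond mulr_sumr -(pair_big_dep xpredT (fun z z' => A (z, z'))
    (fun z z' => 2 * W (z, z')))/=.
  apply: ler_sum => z _; case: ifP => [/exists_inP[n nQ zn]|_]; last first.
    by apply: sumr_ge0 => z' _; rewrite mulr_ge0.
  have := few_hits_unlikely em3 (QE n nQ); rewrite -/M => few.
  have := sum_sample_weight.
  rewrite (bigID (fun z' => (hits (E n) z')%:R <= 2 * M)) /= => tot.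
  rewrite -mulr_sumr /W /= -mulr_sumr mulrCA ler_peMr ?sample_weight_ge0//.
  have : \sum_(z' | ~~ ((hits (E n) z')%:R <= 2 * M)) sample_weight z' <=
     \sum_(z' | A (z, z')) sample_weight z'.
    rewrite [leLHS]big_mkcond [leRHS]big_mkcond; apply: ler_sum => z' _ /=.
    case: ifPn => [h|_]; last by case: ifP => // _; exact: sample_weight_ge0.
    rewrite ifT//; apply/exists_inP; exists n => //=.
    by rewrite zn /= ltW// ltNge.
  lra.
(* Swaps preserve the weight of a double sample, so the weight of [A] may be averaged over all
   [2 ^ m] swaps with the double sample held fixed. *)
have swapped s : \sum_(u | A u) W u = \sum_u (A (swap s u))%:R * W u.
  rewrite big_mkcond (reindex_inj (inv_inj (swapK s))) /=.
  apply: eq_bigr => u _; rewrite /W sample_weight_swap.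
  by case: ifP; rewrite ?mul1r ?mul0r.
have avg : 2 ^+ m * \sum_(u | A u) W u =
    \sum_u (\sum_s (A (swap s u))%:R) * W u.
  under [RHS]eq_bigr => u _ do rewrite mulr_suml.
  rewrite exchange_big /= -(eq_bigr _ (fun s _ => swapped s)) sumr_const.
  by rewrite card_ffun card_bool card_ord -natrX mulr_natl.
have main u : (\sum_s (A (swap s u))%:R) * W u <=
    2 ^+ m * (G * expR (- (5 / 32) * M)) * W u.
  (* Double samples of weight zero contribute nothing, so the trace bound is needed on the support
     only. *)
  have [->|Wn] := eqVneq (W u) 0; first by rewrite !mulr0.
  apply: ler_wpM2r => //.
  have supp : (forall i, nu (u.1 i) != 0) /\ (forall i, nu (u.2 i) != 0).
    by move: Wn; rewrite mulf_eq0 negb_or => /andP[/prodf_neq0 h1 /prodf_neq0 h2];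
      split=> i; [apply: h1|apply: h2].
  set e0 := expR _.
  have e00 : 0 <= e0 by exact: expR_ge0.
  (* Markov's inequality: when the swap lands in [A], the term of the culprit's trace is already at
     least 1, since [e0] inverts the bound of [skewed_swap_weight]. *)
  apply: (@le_trans _ _ (\sum_(s : {ffun 'I_m -> bool})
      \sum_(t in [set bit_trace E u n | n in Q])
        e0 * \prod_i swap_weight (s i) (t i))).
    apply: ler_sum => s _.
    have pos t : 0 <= e0 * \prod_i swap_weight (s i) (t i).
      rewrite mulr_ge0//; apply: prodr_ge0 => i _; rewrite mulr_ge0// exprn_ge0//; lra.
    have [/exists_inP[n nQ /andP[h1 h2]]|_] := boolP (A _); last exact: sumr_ge0.
    rewrite (bigD1 (bit_trace E u n)) ?imset_f//= ler_wpDr ?sumr_ge0//.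
    have -> : \prod_i swap_weight (s i) (bit_trace E u n i) =
        (2 / 3) ^+ hits (E n) (swap s u).1 * (4 / 3) ^+ hits (E n) (swap s u).2.
      rewrite /hits -!prodrXr -big_split; apply: eq_bigr => i _.
      by rewrite /swap_weight !ffunE /=; case: (s i).
    have := skewed_swap_weight _ h1 h2 => /(_ _)/(ler_wpM2l e00).
    rewrite -expRD mulNr addNr expR0; apply.
    lra.
  rewrite exchange_big /=.
  apply: (@le_trans _ _ (\sum_(t in [set bit_trace E u n | n in Q]) e0 * 2 ^+ m)).
    by apply: ler_sum => t _; rewrite -mulr_sumr ler_wpM2l ?sum_swap_weight.
  rewrite sumr_const -[leLHS]mulr_natl mulrA [leLHS]mulrC.
  by rewrite ler_wpM2l ?exprn_ge0// ler_wpM2r// (HG u supp.1 supp.2).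
apply: le_trans ghost _; rewrite -mulrA ler_pM2l//.
rewrite -(@ler_pM2l _ (2 ^+ m)) ?exprn_gt0// avg.
apply: le_trans (ler_sum _ (fun u _ => main u)) _.
rewrite -mulr_sumr; suff -> : \sum_u W u = 1 by rewrite mulr1.
rewrite -(pair_big xpredT xpredT (fun z z' => W (z, z')))/=.
under eq_bigr => z _ do rewrite /W /= -mulr_sumr sum_sample_weight mulr1.
exact: sum_sample_weight.
Qed.

End Symmetrization.

(** * Sample size and growth of the bag traces *)

Lemma sample_size_bound (K : realType) (d q m : nat) (e delta : K) :
  (1 <= d)%N -> (2 <= q)%N -> 0 < e -> e < 1 / (4 * q%:R) -> 0 < delta <= 1 ->
  100 * d%:R * (ln q%:R + ln (1 / delta)) / e ^+ 2 <= m%:R ->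
  let t := e / (32 * q%:R) in
  3 <= e * m%:R /\
  2 * ((1 + t) ^+ (2 * (m * q)) / t ^+ d.+1) * expR (- (5 / 32) * (e * m%:R))
    <= delta.
Proof.
move=> d1 q2 e0 eq4 /andP[de0 de1] hm t.
have qR : 2 <= q%:R :> K by rewrite (ler_nat _ 2).
have dR : 1 <= d%:R :> K by rewrite (ler_nat _ 1).
have ln2 : 1 / 2 <= ln (2 : K).
  have -> : (2 : K) = (1 + - (1 / 2))^-1.
    by rewrite (_ : 1 + - (1 / 2) = 2^-1) ?invrK//; lra.
  rewrite lnV ?posrE; last lra.
  by have := @le_ln1Dx K (- (1 / 2)); lra.
have lnq : ln 2 <= ln q%:R :> K by rewrite ler_ln ?posrE//; lra.
have lnd : 0 <= ln (1 / delta) by rewrite ln_ge0// ler_pdivlMr// mul1r.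
pose x := 1 / e.
have xe : x * e = 1 by rewrite /x div1r mulVf// gt_eqF.
have x0 : 0 < x by rewrite divr_gt0.
have x8 : 8 <= x.
  move: eq4; rewrite ltr_pdivlMr; last lra.
  by nra.
have lnx : ln x <= x by apply/ltW/ln_sublinear.
set l := ln q%:R in lnq hm *; set y := ln (1 / delta) in lnd hm *.
have em : 100 * d%:R * (l + y) * x <= e * m%:R.
  rewrite (_ : _ * x = e * (100 * d%:R * (l + y) / e ^+ 2)) ?ler_pM2l//.
  by rewrite /x; field; rewrite gt_eqF.
have t0 : 0 < t by rewrite /t divr_gt0//; lra.
have lnt : - ln t = 5 * ln 2 + l + ln x.
  rewrite -lnV ?posrE// (_ : t^-1 = 2 ^+ 5 * q%:R * x); last first.
    by rewrite /t /x invf_div mul1r -natrX.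
  have q0 : 0 < q%:R :> K by lra.
  have p0 : 0 < 2 ^+ 5 * q%:R :> K by rewrite mulr_gt0 ?exprn_gt0.
  rewrite lnM ?posrE// lnM ?posrE ?exprn_gt0// lnXn//.
  by rewrite [5 * _]mulr_natl.
have [L1 L2] : 1 <= d%:R * (l + y) * x /\ d%:R * l * x <= d%:R * (l + y) * x.
  split; last by rewrite ler_pM2r// ler_pM2l; lra.
  have : 1 / 2 <= d%:R * (l + y) by nra.
  by nra.
split; first by lra.
(* With [t = e / (32 q)] one has [2 m q t = e m / 16], so the growth factor uses only part of the
   exponent [5 e m / 32]. *)
have p1 : (1 + t) ^+ (2 * (m * q)) <= expR (e * m%:R / 16).
  apply: (@le_trans _ _ (expR t ^+ (2 * (m * q)))).
    by rewrite lerXn2r ?nnegrE ?expR_ge0// ?expR_ge1Dx//; lra.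
  rewrite -expRM_natl ler_expR !natrM /t le_eqVlt; apply/orP; left; apply/eqP.
  by field; rewrite gt_eqF//; lra.
have p2 : (t ^+ d.+1)^-1 = expR (d.+1%:R * - ln t).
  by rewrite expRM_natl expRN lnK ?posrE// exprVn.
have p3 : delta = expR (- y).
  by rewrite /y expRN div1r lnV ?posrE// expRN lnK ?posrE// invrK.
have p4 : 2 = expR (ln 2) :> K by rewrite lnK ?posrE.
rewrite [leRHS]p3 p2 {1}p4.
apply: (@le_trans _ _ (expR (ln 2) *
    (expR (e * m%:R / 16) * expR (d.+1%:R * - ln t)) *
    expR (- (5 / 32) * (e * m%:R)))).
  by rewrite ler_pM2r ?expR_gt0// ler_pM2l ?expR_gt0// ler_pM2r ?expR_gt0.
(* What remains is [3 e m / 32], more than [9 L] for [L = d (l + y) x], as [e m >= 100 L]. The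
   factor [t ^- (d+1)] costs at most [6 L], and [ln 2 + y] at most [L]. *)
rewrite -!expRD ler_expR lnt -[d.+1]addn1 natrD.
have A1 : 5 * ln 2 + l + ln x <= 3 * (l * x) by nra.
have A2 : (d%:R + 1) * (5 * ln 2 + l + ln x) <= 6 * (d%:R * l * x).
  have B0 : 0 <= l * x by rewrite mulr_ge0; lra.
  by nra.
have A3 : ln 2 + y <= d%:R * (l + y) * x.
  have : l + y <= d%:R * (l + y) by nra.
  by nra.
lra.
Qed.

(** A trace is a function of the labels on the [2 m q] points of the double sample. Patterns of
    nonzero weight are realized by vectors, so these labels are labelings by halfspaces. *)
Lemma card_bag_traces (K : realType) (D q k m N : nat) (T : finType)
    (label : 'I_N -> T -> bool) (v : 'I_N -> 'rV[K]_D) (mu : 'I_q -> T -> K)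
    (Q : {set 'I_N}) (t : K)
    (u : {ffun 'I_m -> {ffun 'I_q -> T}} * {ffun 'I_m -> {ffun 'I_q -> T}}) :
  0 < t <= 1 ->
  (forall j x, mu j x != 0 ->
     exists y, forall n, label n x = positive_on (v n) y) ->
  (forall i, \prod_j mu j (u.1 i j) != 0) ->
  (forall i, \prod_j mu j (u.2 i j) != 0) ->
  #|[set bit_trace (fun n (z : {ffun 'I_q -> T}) =>
         (\sum_j label n (z j))%N != k) u n | n in Q]|%:R
   <= (1 + t) ^+ (2 * (m * q)) / t ^+ D.
Proof.
move=> t01 real s1 s2; have /andP[t0 _] := t01.
pose pt (p : bool * ('I_m * 'I_q)) : T :=
  if p.1 then u.2 p.2.1 p.2.2 else u.1 p.2.1 p.2.2.
have pick p : {y | forall n, label n (pt p) = positive_on (v n) y}.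
  apply: cid; apply: (real p.2.2); case: p => [[] [i j]]; rewrite /pt /=.
    by have /prodf_neq0 := s2 i; apply.
  by have /prodf_neq0 := s1 i; apply.
pose lam n := [ffun p => positive_on (v n) (sval (pick p))].
pose F (l : {ffun bool * ('I_m * 'I_q) -> bool}) : {ffun 'I_m -> bool * bool} :=
  [ffun i => ((\sum_j l (false, (i, j)))%N != k, (\sum_j l (true, (i, j)))%N != k)].
have -> : [set bit_trace (fun n (z : {ffun 'I_q -> T}) =>
      (\sum_j label n (z j))%N != k) u n | n in Q] = F @: [set lam n | n in Q].
  rewrite -imset_comp; apply: eq_imset => n; apply/ffunP => i; rewrite !ffunE /=.
  congr pair; congr (~~ (_ == _)); apply: eq_bigr => j _; rewrite ffunE.
    by rewrite -(svalP (pick (false, (i, j)))).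
  by rewrite -(svalP (pick (true, (i, j)))).
rewrite ler_pdivlMr ?exprn_gt0//.
have := @card_labelings K D t _ _ (fun p => sval (pick p)) v Q t01.
rewrite !card_prod card_bool !card_ord; apply: le_trans.
by rewrite ler_wpM2r ?exprn_ge0 ?ler_nat ?leq_imset_card// ltW.
Qed.

From mathcomp Require Import Rstruct Rstruct_topology.
Local Open Scope classical_set_scope.

(** * Real-valued probabilities and Borel halfspaces *)

Section RealProbability.
Context {dT : measure_display} {T : measurableType dT} {K : realType}.
Variable P : probability T K.

Definition pr (A : set T) : K := fine (P A).

Lemma prK A : measurable A -> P A = (pr A)%:E.
Proof. by move=> mA; rewrite fineK// fin_num_measure. Qed.

Lemma pr_ge0 A : 0 <= pr A.
Proof. exact: fine_ge0. Qed.

Lemma prT : pr setT = 1.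
Proof. by rewrite /pr probability_setT. Qed.

Lemma pr0 : pr set0 = 0.
Proof. by rewrite /pr measure0. Qed.

Lemma le_pr A B : measurable A -> measurable B -> A `<=` B -> pr A <= pr B.
Proof. by move=> mA mB AB; rewrite -lee_fin -!prK// le_measure ?inE. Qed.

Lemma prU A B : measurable A -> measurable B -> A `&` B = set0 ->
  pr (A `|` B) = pr A + pr B.
Proof.
move=> mA mB AB; apply: EFin_inj; rewrite -prK ?EFinD -?prK//; last exact: measurableU.
exact: measureU.
Qed.

Lemma le_prU A B C : measurable A -> measurable B -> measurable C ->
  A `<=` B `|` C -> pr A <= pr B + pr C.
Proof.
move=> mA mB mC ABC; rewrite -lee_fin EFinD -!prK//.
apply: le_trans (measureU2 _ mB mC); apply: le_measure; rewrite ?inE//.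
exact: measurableU.
Qed.

Lemma pr_setIC A B : measurable A -> measurable B ->
  pr A = pr (A `&` B) + pr (A `&` ~` B).
Proof.
move=> mA mB; have mC := measurableC mB.
rewrite -prU; [|exact: measurableI|exact: measurableI|].
  by rewrite -setIUr setUv setIT.
by rewrite setIACA setICr setI0.
Qed.

Lemma pr_vanishing (B : nat -> set T) (eta : K) :
  (forall n, measurable (B n)) -> (forall i j, (i <= j)%N -> B j `<=` B i) ->
  \bigcap_n B n = set0 -> 0 < eta ->
  exists n0, forall n, (n0 <= n)%N -> pr (B n) < eta.
Proof.
move=> mB decB B0 eta0.
have : (P \o B) n @[n --> \oo] --> P (\bigcap_n B n).
  apply: nonincreasing_cvg_mu => //.
  - by rewrite (le_lt_trans (probability_le1 _ _)) ?ltry.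
  - by rewrite B0.
  - by move=> i j ij; apply/subsetPset/decB.
rewrite B0 measure0 => /fine_cvg /cvgrPdist_lt /(_ _ eta0)[n0 _ h]; exists n0 => n /h /=.
by rewrite sub0r normrN ger0_norm// pr_ge0.
Qed.

Lemma pr_bigcup_le (B : nat -> set T) (delta : K) :
  (forall n, measurable (B n)) -> (forall i j, (i <= j)%N -> B i `<=` B j) ->
  (forall n, pr (B n) <= delta) -> pr (\bigcup_n B n) <= delta.
Proof.
move=> mB incB leB; have mU : measurable (\bigcup_n B n) by exact: bigcup_measurable.
rewrite -lee_fin -prK//.
have cv : (P \o B) n @[n --> \oo] --> P (\bigcup_n B n).
  by apply: nondecreasing_cvg_mu => // i j ij; apply/subsetPset/incB.
apply: cvge_le cv; apply: nearW => n /=.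
by rewrite prK// lee_fin.
Qed.

Variables (I : finType) (g : T -> I).
Hypothesis mg : forall i, measurable [set x | g x = i].

Lemma measurable_fibers (Q : pred I) : measurable [set x | Q (g x)].
Proof.
have -> : [set x | Q (g x)] = \bigcup_(i in [set i | Q i]) [set x | g x = i].
  by apply/seteqP; split=> [x Qx|x [i Qi /= ->]//]; exists (g x).
by apply: fin_bigcup_measurable => [|i _]; [exact: finite_finset|exact: mg].
Qed.

Lemma pr_fibers (Q : pred I) (A : set T) : measurable A ->
  pr ([set x | Q (g x)] `&` A) = \sum_(i | Q i) pr ([set x | g x = i] `&` A).
Proof.
move=> mA.
suff H (s : seq I) : uniq s ->
    pr ([set x | g x \in s] `&` A) = \sum_(i <- s) pr ([set x | g x = i] `&` A).
  rewrite -big_filter -H ?filter_uniq ?index_enum_uniq//; congr (pr (_ `&` _)).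
  by apply/seteqP; split=> x /=; rewrite mem_filter mem_index_enum andbT.
elim: s => [_|i s IH /=/andP[ins us]].
  rewrite big_nil (_ : _ `&` _ = set0) ?pr0//.
  by apply/seteqP; split=> x //= [].
rewrite big_cons -IH// -prU.
- congr pr; rewrite -setIUl; congr (_ `&` _); apply/seteqP; split=> x /=.
    by rewrite inE => /orP[/eqP|]; [left|right].
  by rewrite inE => -[->|->]; rewrite ?eqxx ?orbT.
- exact: measurableI.
- by apply: measurableI => //; exact: (measurable_fibers (mem s)).
- apply/seteqP; split=> x //= [[gi _] [gs _]].
  by move: ins; rewrite -gi gs.
Qed.
End RealProbability.

Lemma open_halfspace (K : realType) (d : nat) (r : 'rV[K]_d) (c : K) :
  open [set x : 'rV[K]_d | 0 < \sum_(i < d) r ord0 i * x ord0 i + c].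
Proof.
have H : continuous (fun y : 'rV[K]_d => \sum_(i < d) r ord0 i * y ord0 i).
  apply: continuous_big => [|i _ y]; first exact: add_continuous.
  apply: (@continuousM K 'rV[K]_d (fun=> _) (fun y : 'rV[K]_d => y ord0 i)).
    exact: cst_continuous.
  exact: coord_continuous.
have := @open_comp 'rV[K]_d K
  (fun y : 'rV[K]_d => \sum_(i < d) r ord0 i * y ord0 i) [set y | - c < y].
rewrite (_ : _ @^-1` _ =
    [set x : 'rV[K]_d | 0 < \sum_(i < d) r ord0 i * x ord0 i + c]).
  apply; last exact: open_gt.
  by move=> x _; exact: H.
by apply/seteqP; split=> x /=; rewrite -ltrBlDr sub0r.
Qed.

Section Halfspaces.
Variables (K : realType) (d : nat).
Implicit Types (r x : 'rV[K]_d) (c : K).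

Definition score r c x : K := (\sum_(i < d) r ord0 i * x ord0 i) + c.
Definition label r c x : bool := 0 < score r c x.

(** Homogenization: an affine halfspace in dimension [d] is a linear one in dimension [d + 1],
    whence the exponent [d.+1] later. *)
Lemma label_positive_on r c x :
  label r c x = positive_on (row_mx r c%:M) (col_mx x^T 1%:M).
Proof.
rewrite /label /positive_on mul_row_col mulmx1 !mxE eqxx mulr1n; congr (_ < _).
by rewrite /score; congr (_ + _); apply: eq_bigr => i _; rewrite !mxE.
Qed.
End Halfspaces.

Section BorelHalfspaces.
Variable d : nat.
Implicit Types (r : 'rV[R]_d) (c : R) (x : Rd d).

Lemma ltfE r c x : ltf r c x = (label r c x)%:R.
Proof. by rewrite /ltf /pos -/(score r c x) -/(label r c x); case: label. Qed.

Lemma measurable_label r c : measurable [set x : Rd d | label r c x].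
Proof.
apply: sub_sigma_algebra.
exact: (@open_halfspace R).
Qed.

Lemma measurable_label_eq r c (b : bool) : measurable [set x : Rd d | label r c x = b].
Proof.
case: b; first exact: measurable_label.
rewrite (_ : [set x | _] = ~` [set x : Rd d | label r c x]).
  by apply: measurableC; exact: measurable_label.
by apply/seteqP; split=> x /=; case: label.
Qed.

Lemma measurable_label_rel r r' c c' (Q : rel bool) :
  measurable [set x : Rd d | Q (label r c x) (label r' c' x)].
Proof.
apply: (@measurable_fibers _ _ _ (fun x : Rd d => (label r c x, label r' c' x))
  _ (fun b => Q b.1 b.2)) => -[b b'].
rewrite (_ : [set x | _] =
    [set x : Rd d | label r c x = b] `&` [set x : Rd d | label r' c' x = b']).
  by apply: measurableI; exact: measurable_label_eq.
by apply/seteqP; split=> x /= [-> ->].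
Qed.
End BorelHalfspaces.

(** * Approximation by countably many halfspaces *)

Section RationalHalfspaces.
Variables (K : realType) (d : nat).
Implicit Types (r x : 'rV[K]_d) (c : K).

(** Indexing by [nat] makes the initial segments finite classes; numbers that code nothing yield the
    empty halfspace. *)
Definition rational_halfspace (n : nat) : 'rV[K]_d * K :=
  if unpickle n is Some (r, c) then (map_mx ratr (r : 'rV[rat]_d), ratr (c : rat))
  else (0, 0).

Definition rational_label n x :=
  label (rational_halfspace n).1 (rational_halfspace n).2 x.

Lemma rational_halfspaceP (r : 'rV[rat]_d) (c : rat) :
  exists n, rational_halfspace n = (map_mx ratr r, ratr c).
Proof. by exists (pickle (r, c)); rewrite /rational_halfspace pickleK. Qed.

(* Lowering the threshold by about 1/k while moving the normal by 1/k^2 keeps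
   the points of the boundary hyperplane on the nonpositive side. *)
Lemma rational_halfspace_near r c (k : nat) : exists n,
  (forall i, `|(rational_halfspace n).1 ord0 i - r ord0 i| <= k.+1%:R^-1 ^+ 2) /\
  c - 2 * k.+1%:R^-1 <= (rational_halfspace n).2 <= c - k.+1%:R^-1.
Proof.
have e0 : 0 < k.+1%:R^-1 :> K by rewrite invr_gt0.
set e := k.+1%:R^-1 in e0 *.
have e20 : 0 < e ^+ 2 by rewrite exprn_gt0.
have near (y z : K) : y < z -> exists p : rat, y < ratr p < z.
  by move=> /rat_in_itvoo[p]; rewrite in_itv /=; exists p.
have [p hp] : exists p : 'rV[rat]_d, forall i, `|ratr (p ord0 i) - r ord0 i| <= e ^+ 2.
  have pick i : {p : rat | `|ratr p - r ord0 i| <= e ^+ 2}.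
    apply: cid; have [|p] := near (r ord0 i - e ^+ 2) (r ord0 i + e ^+ 2).
      by lra.
    by exists p; rewrite ler_norml; lra.
  by exists (\row_i sval (pick i)) => i; rewrite mxE; exact: (svalP (pick i)).
have [|b hb] := near (c - 2 * e) (c - e); first by lra.
have [n nE] := rational_halfspaceP p b; exists n; rewrite nE; split=> [i|/=].
  by rewrite /= mxE.
by lra.
Qed.

(** With [e = 1/(k+1)], the normal shifts the score of [x] by at most [e^2 S <= e] for large [k].
    Lowering the threshold by at least [e] keeps nonpositive scores nonpositive, and the total loss
    of at most [3 e] keeps a score above [4 e] positive. *)
Lemma rational_label_cvg r c : exists s : nat -> nat,
  forall x, exists k0, forall k, (k0 <= k)%N -> rational_label (s k) x = label r c x.
Proof.
have [s hs] := choice (rational_halfspace_near r c); exists s => x.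
pose S : K := \sum_(i < d) `|x ord0 i|.
have S0 : 0 <= S by apply: sumr_ge0.
have diff k : `|score (rational_halfspace (s k)).1 0 x - score r 0 x| <= k.+1%:R^-1 ^+ 2 * S.
  rewrite /score !addr0 -sumrB mulr_sumr; apply: le_trans (ler_norm_sum _ _ _) _.
  apply: ler_sum => i _; rewrite -mulrBl normrM ler_wpM2r//.
  exact: (hs k).1.
have scoreD r' c' : score r' c' x = score r' 0 x + c' by rewrite /score addr0.
(* beyond this bound, 1/k <= 1/S and, if the score is positive, 4/k is below it *)
pose Y : K := Num.max S (4 / score r c x).
exists (Num.bound Y) => k k0k.
have e0 : 0 < k.+1%:R^-1 :> K by rewrite invr_gt0.
have [YS Yp] : S <= Y /\ 4 / score r c x <= Y by rewrite !le_max !lexx orbT.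
have kY : Y * k.+1%:R^-1 <= 1.
  rewrite ler_pdivrMr ?ltr0Sn// mul1r.
  apply: le_trans (ltW (archi_boundP _)) _; first exact: le_trans YS.
  by rewrite ler_nat; apply: leq_trans k0k _.
have [dk /andP[c1 c2]] := hs k; have := diff k; rewrite ler_norml => /andP[d1 d2].
set e := k.+1%:R^-1 in e0 kY c1 c2 d1 d2.
have eS : e ^+ 2 * S <= e.
  have Se : S * e <= 1 by apply: le_trans kY; rewrite ler_wpM2r// ltW.
  by nra.
have E1 := scoreD r c; rewrite /rational_label /label scoreD.
have [pos|npos] := ltP 0 (score r c x).
  have : 4 * e <= score r c x.
    rewrite -[leRHS]mul1r -ler_pdivrMr// mulrAC; apply: le_trans kY.
    by rewrite ler_wpM2r// ltW.
  by move=> e4; apply/idP; lra.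
by apply/negbTE; rewrite -leNgt; lra.
Qed.

End RationalHalfspaces.

(** Eventual equality at each point gives exactness on the finite family by taking a maximum, and
    small measure by continuity from above along the decreasing tail unions [B k]. *)
Lemma rational_label_approx (d : nat) (D : probability (Rd d) R)
    (r : 'rV[R]_d) (c : R) (I : finType)
    (y : I -> Rd d) (eta : R) : 0 < eta ->
  exists n, (forall i, rational_label n (y i) = label r c (y i)) /\
    pr D [set x : Rd d | rational_label n x != label r c x] < eta.
Proof.
move=> eta0; have [s hs] := rational_label_cvg r c.
pose A k := [set x : Rd d | rational_label (s k) x != label r c x].
have mA k : measurable (A k).
  exact: (measurable_label_rel _ _ _ _ (fun b b' => b != b')).
pose B k := \bigcup_(j in [set j | (k <= j)%N]) A j.
have mB k : measurable (B k) by apply: bigcup_measurable.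
have B0 : \bigcap_k B k = set0.
  apply/seteqP; split=> x //= h; have [k0 hk] := hs x.
  have [j /= kj] := h k0 Logic.I; by rewrite /A /= hk// eqxx.
have [|K1 hK1] := pr_vanishing D mB _ B0 eta0.
  by move=> i j ij x [l /= jl Al]; exists l => //=; exact: leq_trans jl.
have [K2 hK2] : exists k0, forall i k, (k0 <= k)%N ->
    rational_label (s k) (y i) = label r c (y i).
  have pick i := cid (hs (y i)).
  exists (\max_i sval (pick i)) => i k le; apply: (svalP (pick i)).
  by apply: leq_trans le; exact: (leq_bigmax i).
exists (s (maxn K1 K2)); split=> [i|]; first by rewrite hK2// leq_maxr.
apply: le_lt_trans (hK1 _ (leq_maxl K1 K2)); apply: le_pr; [exact: mA|exact: mB|].
by move=> x Ax; exists (maxn K1 K2) => /=.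
Qed.

(** * The bag oracle *)

Definition accurate (d : nat) (D : probability (Rd d) R) (f h : Rd d -> R)
    (q k : nat) (eps : R) : Prop :=
  (k%:R != q%:R / 2 :> R -> disagree D f h <= 4 * eps) /\
  (k%:R = q%:R / 2 :> R ->
     disagree D f h <= 4 * eps \/ disagree D f (fun x => 1 - h x) <= 4 * eps).

Lemma bool_natr_inj (K : numDomainType) : injective (fun b : bool => b%:R : K).
Proof. by move=> [] [] //= /eqP; rewrite ?oner_eq0// eq_sym oner_eq0. Qed.

Section Oracle.
Variables (d : nat) (D : probability (Rd d) R) (r0 : 'rV[R]_d) (c0 : R).
Implicit Types (r : 'rV[R]_d) (c : R).

Definition side (b : bool) : set (Rd d) := [set x | label r0 c0 x = b].

Lemma measurable_side b : measurable (side b).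
Proof. exact: measurable_label_eq. Qed.

Definition cond_pr (b : bool) (A : set (Rd d)) : R :=
  pr D (A `&` side b) / pr D (side b).

Lemma ltf_side (b : bool) : [set x | ltf r0 c0 x = b%:R] = side b.
Proof.
apply/seteqP; split=> x; rewrite /side /= ltfE; last by move->.
exact: bool_natr_inj.
Qed.

Lemma cond_probE (b : bool) A :
  cond_prob D (ltf r0 c0) (if b then 1 else 0) A = cond_pr b A.
Proof.
have -> : (if b then 1 else 0) = b%:R :> R by case: b.
by rewrite /cond_prob ltf_side.
Qed.

Lemma disagreeE r c : disagree D (ltf r0 c0) (ltf r c) =
  pr D [set x : Rd d | label r0 c0 x != label r c x].
Proof.
rewrite /disagree /pr; congr (fine (D _)); apply/seteqP; split=> x /=; rewrite !ltfE.
  by move=> h; apply/eqP => e; apply: h; rewrite e.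
by move=> /eqP h /bool_natr_inj.
Qed.

Lemma disagreeCE r c : disagree D (ltf r0 c0) (fun x => 1 - ltf r c x) =
  pr D [set x : Rd d | label r0 c0 x == label r c x].
Proof.
rewrite /disagree /pr; congr (fine (D _)); apply/seteqP; split=> x /=;
  rewrite !ltfE (_ : 1 - _ = (~~ label r c x)%:R); try by case: label; rewrite ?subrr ?subr0.
  by move=> h; apply/eqP; apply: contra_notP h => /eqP; case: label; case: label.
by move=> /eqP -> /bool_natr_inj; case: label.
Qed.

Hypothesis side_gt0 : forall b, 0 < pr D (side b).

Lemma cond_pr_ge0 b A : 0 <= cond_pr b A.
Proof. by rewrite divr_ge0 ?pr_ge0. Qed.

Lemma cond_prT b : cond_pr b setT = 1.
Proof. by rewrite /cond_pr setTI divff// gt_eqF. Qed.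

Lemma cond_pr_fibers (I : finType) (g : Rd d -> I) (Q : pred I) b :
  (forall i, measurable [set x | g x = i]) ->
  cond_pr b [set x | Q (g x)] = \sum_(i | Q i) cond_pr b [set x | g x = i].
Proof.
move=> mg; rewrite /cond_pr (pr_fibers D mg)//; last exact: measurable_side.
by rewrite mulr_suml.
Qed.

Lemma cond_pr_le1 b A : measurable A -> cond_pr b A <= 1.
Proof.
move=> mA; have ms := measurable_side b; rewrite ler_pdivrMr// mul1r.
by apply: le_pr => //; apply: measurableI.
Qed.

(** Total probability over the true label; [b = false] measures the error of the hypothesis,
    [b = true] that of its complement. *)
Lemma disagree_cond r c (b : bool) :
  pr D [set x : Rd d | (label r c x == label r0 c0 x) == b] =
  let s b' := cond_pr b' [set x | label r c x] in
  pr D (side true) * (if b then s true else 1 - s true) +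
  pr D (side false) * (if b then 1 - s false else s false).
Proof.
rewrite /=; have mL := @measurable_label d r c; have mN := measurableC mL.
have ms := measurable_side.
have H b' : pr D (side b') * (1 - cond_pr b' [set x | label r c x]) =
    pr D (~` [set x : Rd d | label r c x] `&` side b').
  have := pr_setIC D (ms b') mL; rewrite [X in pr D X = _]/= mulrBr mulr1.
  rewrite /cond_pr mulrCA divff ?gt_eqF// mulr1 [side b' `&` _]setIC.
  by rewrite [side b' `&` _]setIC => ->; rewrite addrAC subrr add0r.
have H' b' : pr D (side b') * cond_pr b' [set x | label r c x] =
    pr D ([set x : Rd d | label r c x] `&` side b').
  by rewrite /cond_pr mulrCA divff ?gt_eqF// mulr1.
case: b; rewrite H H' -prU; try exact: measurableI.
- congr pr; apply/seteqP; split=> x; rewrite /side /=;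
  by case: (label r c x); case: (label r0 c0 x) => /=; intuition.
- by apply/seteqP; split=> x //= [[h _] [h' _]].
- congr pr; apply/seteqP; split=> x; rewrite /side /=;
  by case: (label r c x); case: (label r0 c0 x) => /=; intuition.
- by apply/seteqP; split=> x //= [[h _] [h' _]].
Qed.

(** The coefficient is the probability that a bag is judged correctly. Were it above [1 - 4 eps],
    concentration would bound both conditional errors of the hypothesis, or of its complement, and
    the overall error is a convex combination of these. *)
Lemma inaccurate_bag_error r c (q k : nat) (eps : R) :
  (1 <= k <= q.-1)%N -> 4 * eps < 1 / 2 ->
  ~ accurate D (ltf r0 c0) (ltf r c) q k eps ->
  (\prod_(j < q) bernoulli_poly (cond_pr (j < k)%N [set x | label r c x]))`_k <= 1 - 4 * eps.
Proof.
move=> kq e2 nacc; rewrite leNgt; apply/negP => /ltW H; apply: nacc.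
set s1 := cond_pr true [set x | label r c x].
set s0 := cond_pr false [set x | label r c x].
have ML := @measurable_label d r c.
have s1P : 0 <= s1 <= 1 by rewrite cond_pr_ge0 cond_pr_le1.
have s0P : 0 <= s0 <= 1 by rewrite cond_pr_ge0 cond_pr_le1.
have tot : pr D (side true) + pr D (side false) = 1.
  rewrite -(prT D) -prU; try exact: measurable_side.
    by congr pr; apply/seteqP; split=> x //= _; rewrite /side /=; case: label; [left|right].
  by apply/seteqP; split=> x //= []; rewrite /side /= => ->.
have g1 := side_gt0 true; have g0 := side_gt0 false.
rewrite (eq_bigr (fun j : 'I_q =>
  bernoulli_poly (if (j < k)%N then s1 else s0))) in H; last first.
  by move=> j _; case: (j < k)%N.
case: (bernoulli_bag_concentration kq s1P s0P e2 H) => [[h1 h0]|[kk h1 h0]].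
  have dis : disagree D (ltf r0 c0) (ltf r c) <= 4 * eps.
    rewrite disagreeE; have := disagree_cond r c false; rewrite /= -/s1 -/s0.
    rewrite (_ : [set x | _] = [set x : Rd d | label r0 c0 x != label r c x]).
      by move->; nra.
    by apply/seteqP; split=> x /=; rewrite eqbF_neg eq_sym.
  by split=> // _; left.
have qk : k%:R = q%:R / 2 :> R.
  by rewrite -kk natrD; lra.
split=> [|_]; first by rewrite qk eqxx.
right; rewrite disagreeCE; have := disagree_cond r c true; rewrite /= -/s1 -/s0.
rewrite (_ : [set x | _] = [set x : Rd d | label r0 c0 x == label r c x]).
  by move->; nra.
by apply/seteqP; split=> x /=; rewrite eqb_id eq_sym.
Qed.
End Oracle.

Definition bag_misses (d q k m : nat) (l : Rd d -> bool)
    (M : 'I_m -> 'I_q -> Rd d) : nat :=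
  (\sum_(i < m) ((\sum_(j < q) l (M i j))%N != k))%N.

Lemma bag_err_misses (d q k m : nat) (r : 'rV[R]_d) (c eps : R)
    (M : 'I_m -> 'I_q -> Rd d) :
  (0 < q)%N -> (0 < m)%N -> bag_err k (ltf r c) M <= eps ->
  (bag_misses k (label r c) M)%:R <= eps * m%:R.
Proof.
move=> q0 m0; rewrite /bag_err RdivE ler_pdivrMr ?ltr0n//.
suff -> : #|[set i : 'I_m | bag_avg (ltf r c) (M i) != k%:R / q%:R]| =
    bag_misses k (label r c) M by [].
rewrite -sum1_card big_mkcond; apply: eq_bigr => i _.
have -> : (i \in [set i : 'I_m | bag_avg (ltf r c) (M i) != k%:R / q%:R]) =
    (bag_avg (ltf r c) (M i) != k%:R / q%:R) by apply/idP/idP; rewrite inE.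
have -> : bag_avg (ltf r c) (M i) = (\sum_(j < q) label r c (M i j))%N%:R / q%:R.
  rewrite /bag_avg RdivE natr_sum; congr (_ / _); apply: eq_bigr => j _; exact: ltfE.
rewrite (can_eq (divfK _)) ?pnatr_eq0 -?lt0n// eqr_nat.
by case: eqP.
Qed.

(** * Finitely many rational hypotheses: reduction to label patterns *)

Section FiniteClass.
Variables (d : nat) (D : probability (Rd d) R) (r0 : 'rV[R]_d) (c0 : R).
Variables (q k m N : nat) (eps : R).
Context (dO : measure_display) (O : measurableType dO) (P : probability O R).
Variable X : 'I_m -> 'I_q -> O -> Rd d.
Hypothesis side_gt0 : forall b, 0 < pr D (side r0 c0 b).
Hypothesis kq : (1 <= k <= q.-1)%N.
Hypothesis XP : bags_from_oracle P D (ltf r0 c0) k X.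

Local Notation pattern := {ffun 'I_N -> bool}.

Definition pattern_of (x : Rd d) : pattern := [ffun n : 'I_N => rational_label n x].

Lemma measurable_pattern t : measurable [set x | pattern_of x = t].
Proof.
rewrite (_ : [set x | _] =
    \bigcap_(n in [set: 'I_N]) [set x : Rd d | rational_label n x = t n]).
  apply: fin_bigcap_measurable; first exact: finite_finset.
  by move=> n _; exact: measurable_label_eq.
apply/seteqP; split=> x /=; first by move=> <- n _ /=; rewrite ffunE.
by move=> h; apply/ffunP => n; rewrite ffunE; exact: h.
Qed.

Definition pattern_weight (j : 'I_q) (t : pattern) : R :=
  cond_pr D r0 c0 (j < k)%N [set x | pattern_of x = t].

Lemma sum_pattern_weight j (n : 'I_N) :
  \sum_(t : pattern | t n) pattern_weight j t =
  cond_pr D r0 c0 (j < k)%N [set x | rational_label n x].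
Proof.
rewrite -(cond_pr_fibers D r0 c0 (fun t : pattern => t n) _ measurable_pattern).
by congr cond_pr; apply/seteqP; split=> x /=; rewrite ffunE.
Qed.

Lemma sum_pattern_weightT j : \sum_t pattern_weight j t = 1.
Proof.
rewrite -(cond_pr_fibers D r0 c0 xpredT _ measurable_pattern) -(cond_prT side_gt0 (j < k)%N).
by congr cond_pr; apply/seteqP; split=> x.
Qed.

Definition bag_weight (z : {ffun 'I_q -> pattern}) : R :=
  \prod_j pattern_weight j (z j).

Definition bag_miss (n : 'I_N) (z : {ffun 'I_q -> pattern}) : bool :=
  (\sum_j z j n)%N != k.

Lemma bag_weight_ge0 z : 0 <= bag_weight z.
Proof. by apply: prodr_ge0 => j _; exact: cond_pr_ge0. Qed.

Lemma sum_bag_weight : \sum_z bag_weight z = 1.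
Proof.
rewrite -(bigA_distr_bigA pattern_weight) big1// => j _.
exact: sum_pattern_weightT.
Qed.

Lemma bag_miss_weight (n : 'I_N) : 4 * eps < 1 / 2 ->
  ~ accurate D (ltf r0 c0)
      (ltf (rational_halfspace R d n).1 (rational_halfspace R d n).2) q k eps ->
  4 * eps <= \sum_(z | bag_miss n z) bag_weight z.
Proof.
move=> e2 /(inaccurate_bag_error side_gt0 kq e2) coef.
have := sum_bag_weight; rewrite (bigID (bag_miss n))/=.
(* The bits of hypothesis [n] on the points of a bag are independent, so a correct judgement,
   meaning exactly [k] ones, has the [k]-th coefficient as its probability. *)
suff -> : \sum_(z | ~~ bag_miss n z) bag_weight z =
    (\prod_(j < q) bernoulli_poly (cond_pr D r0 c0 (j < k)%N
       [set x | rational_label n x]))`_k.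
  by move: coef; rewrite /rational_label; lra.
rewrite coef_bernoulli_prod.
have := sum_prod_bits pattern_weight (fun t : pattern => t n)
  (fun b => (\sum_j b j)%N == k).
rewrite (eq_bigl (fun z => ~~ bag_miss n z)) => [->|z]; last first.
  by rewrite /bag_miss negbK; congr (_ == _); apply: eq_bigr => j _; rewrite ffunE.
apply: eq_bigr => b _; apply: eq_bigr => j _; have := sum_pattern_weightT j.
rewrite (bigID (fun t : pattern => t n))/= sum_pattern_weight.
case: (b j) => tot.
  by rewrite -sum_pattern_weight; apply: eq_bigl => t; rewrite eqb_id.
rewrite (eq_bigl (fun t : pattern => ~~ t n)); first by lra.
by move=> t; rewrite eqbF_neg.
Qed.

Definition sample_pattern (w : O) : {ffun 'I_m -> {ffun 'I_q -> pattern}} :=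
  [ffun i => [ffun j => pattern_of (X i j w)]].

Lemma sample_pattern_fiber z : [set w | sample_pattern w = z] =
  [set w | forall p, p \in [set: 'I_m * 'I_q]%SET ->
     [set x | pattern_of x = z p.1 p.2] (X p.1 p.2 w)].
Proof.
apply/seteqP; split=> w /=; first by move=> <- [i j] _; rewrite !ffunE.
move=> h; apply/ffunP => i; apply/ffunP => j; rewrite !ffunE.
by apply: (h (i, j)); rewrite inE.
Qed.

Lemma measurable_sample_pattern z : measurable [set w | sample_pattern w = z].
Proof.
have [mX _] := XP.
rewrite (_ : [set w | _] = \bigcap_(p in [set: 'I_m * 'I_q])
    (X p.1 p.2 @^-1` [set x | pattern_of x = z p.1 p.2])).
  apply: fin_bigcap_measurable; first exact: finite_finset.
  move=> p _; rewrite -[X in measurable X]setTI; apply: mX => //.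
  exact: measurable_pattern.
rewrite sample_pattern_fiber; apply/seteqP; split=> w /= h p => [_|_].
  by apply: h; rewrite inE.
exact: h.
Qed.

(** The passage from the abstract probability space to finite sums: independence gives the product,
    and the oracle laws give its factors. *)
Lemma pr_sample_pattern z :
  pr P [set w | sample_pattern w = z] = sample_weight bag_weight z.
Proof.
have [_ [ind law]] := XP.
rewrite sample_pattern_fiber /pr.
rewrite (ind _ (fun i j => [set x | pattern_of x = z i j])); last first.
  by move=> i j; exact: measurable_pattern.
rewrite /sample_weight /bag_weight pair_big /=; apply: eq_big => [p|p _].
  by rewrite inE.
rewrite law; last exact: measurable_pattern.
exact: cond_probE.
Qed.

Definition inaccurate_class : {set 'I_N} := finset (fun n : 'I_N =>
  `[< ~ accurate D (ltf r0 c0)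
        (ltf (rational_halfspace R d n).1 (rational_halfspace R d n).2) q k eps >]).

Definition fooled_by (z : {ffun 'I_m -> {ffun 'I_q -> pattern}}) : bool :=
  [exists n in inaccurate_class, (hits (bag_miss n) z)%:R <= eps * m%:R].

Definition fooled_samples : set O := [set w | exists2 n : 'I_N,
  ~ accurate D (ltf r0 c0)
      (ltf (rational_halfspace R d n).1 (rational_halfspace R d n).2) q k eps &
  (bag_misses k (rational_label n) (fun i j => X i j w))%:R <= eps * m%:R].

Lemma fooled_samplesE : fooled_samples = [set w | fooled_by (sample_pattern w)].
Proof.
have missE n w : hits (bag_miss n) (sample_pattern w) =
    bag_misses k (rational_label n) (fun i j => X i j w).
  apply: eq_bigr => i _; rewrite /bag_miss ffunE; congr (nat_of_bool (_ != _)).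
  by apply: eq_bigr => j _; rewrite !ffunE.
apply/seteqP; split=> w /=.
  move=> [n nacc le]; apply/exists_inP; exists n; rewrite ?missE//.
  by rewrite inE; apply/asboolP.
by move=> /exists_inP[n]; rewrite inE missE => /asboolP; exists n.
Qed.

Lemma measurable_fooled_samples : measurable fooled_samples.
Proof. rewrite fooled_samplesE; exact: measurable_fibers measurable_sample_pattern _. Qed.

Lemma pr_fooled_samples (t : R) :
  4 * eps < 1 / 2 -> 0 < t <= 1 -> 3 <= eps * m%:R ->
  pr P fooled_samples <=
  2 * ((1 + t) ^+ (2 * (m * q)) / t ^+ d.+1) * expR (- (5 / 32) * (eps * m%:R)).
Proof.
move=> e2 t01 em3; rewrite fooled_samplesE -[X in pr P X]setIT.
rewrite (pr_fibers P measurable_sample_pattern fooled_by)//.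
rewrite (eq_bigr (@sample_weight _ _ bag_weight m)) => [|z _]; last first.
  by rewrite setIT pr_sample_pattern.
apply: uniform_hits_bound => //.
- exact: bag_weight_ge0.
- exact: sum_bag_weight.
- by move=> n; rewrite inE => /asboolP; exact: bag_miss_weight.
move=> u u1 u2; rewrite -[d.+1]addn1.
apply: (@card_bag_traces R (d + 1) q k m N pattern (fun n t => t n)
  (fun n => row_mx (rational_halfspace R d n).1 (rational_halfspace R d n).2%:M)
  pattern_weight inaccurate_class t u t01) => // j s; rewrite /pattern_weight => s0.
(* A pattern with nonzero weight has a nonempty fibre, hence comes from an actual point. *)
have [x xs] : exists x, pattern_of x = s.
  apply: contrapT => none; move: s0; rewrite /cond_pr (_ : [set x | _] = set0).
    by rewrite set0I pr0 mul0r eqxx.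
  by apply/seteqP; split=> x //= xs; apply: none; exists x.
exists (col_mx (x : 'rV[R]_d)^T 1%:M) => n.
by rewrite -label_positive_on -xs ffunE.
Qed.
End FiniteClass.

(** * From rational halfspaces to all halfspaces *)

Lemma inaccurate_near (d : nat) (D : probability (Rd d) R) (r0 r : 'rV[R]_d)
    (c0 c : R) (q k : nat) (eps : R) :
  ~ accurate D (ltf r0 c0) (ltf r c) q k eps ->
  exists2 eta : R, 0 < eta & forall r' c',
    pr D [set x : Rd d | label r' c' x != label r c x] < eta ->
    ~ accurate D (ltf r0 c0) (ltf r' c') q k eps.
Proof.
rewrite /accurate disagreeE disagreeCE.
set a := pr D _; set b := pr D _ => nacc.
(* Inaccuracy is a strict inequality, or two of them when [k = q/2]. By this triangle inequality it
   survives any perturbation of measure below the gap, which serves as [eta]. *)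
have close r' c' (Q : rel bool) :
    pr D [set x : Rd d | Q (label r0 c0 x) (label r c x)] <=
    pr D [set x : Rd d | Q (label r0 c0 x) (label r' c' x)] +
    pr D [set x : Rd d | label r' c' x != label r c x].
  apply: le_prU; [exact: measurable_label_rel|exact: measurable_label_rel| |].
    exact: (measurable_label_rel _ _ _ _ (fun b b' => b != b')).
  move=> x /=; have [->|] := eqVneq (label r' c' x) (label r c x); first by left.
  by right.
have closea r' c' := close r' c' (fun b b' => b != b').
have closeb r' c' := close r' c' (fun b b' => b == b').
have [kq|kq] := eqVneq (k%:R : R) (q%:R / 2).
  have [ha hb] : 4 * eps < a /\ 4 * eps < b.
    by split; rewrite ltNge; apply/negP => h; apply: nacc; split=> [|_];
      rewrite ?kq ?eqxx//; [left|right].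
  exists (Num.min (a - 4 * eps) (b - 4 * eps)); first by rewrite lt_min !subr_gt0 ha hb.
  move=> r' c'; rewrite lt_min disagreeE disagreeCE => /andP[h1 h2] [_ /(_ kq)].
  have := closea r' c'; have := closeb r' c'; rewrite -/a -/b.
  by move=> ? ? []; lra.
have ha : 4 * eps < a.
  rewrite ltNge; apply/negP => h; apply: nacc; split=> // kq'.
  by rewrite kq' eqxx in kq.
exists (a - 4 * eps); first by rewrite subr_gt0.
move=> r' c'; rewrite disagreeE => h1 [/(_ isT) h2 _].
by have := closea r' c'; rewrite -/a; lra.
Qed.

Theorem theorem4 :
  exists C0 : R, 0 < C0 /\
  forall (d : nat) (D : probability (Rd d) R) (r0 : 'rV[R]_d) (c0 : R)
         (q k m : nat) (eps delta : R)
         (dO : measure_display) (O : measurableType dO) (P : probability O R)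
         (X : 'I_m -> 'I_q -> O -> Rd d),
    (2 <= q)%N -> (1 <= k <= q.-1)%N ->
    (0 < D [set x | ltf r0 c0 x = 1%R])%E ->
    (0 < D [set x | ltf r0 c0 x = 0%R])%E ->
    0 < eps -> eps < 1 / (4 * q%:R) -> 0 < delta ->
    m%:R >= C0 * d%:R * (ln q%:R + ln (1 / delta)) / eps ^+ 2 ->
    bags_from_oracle P D (ltf r0 c0) k X ->
    exists G : set O, measurable G /\ ((1 - delta)%:E <= P G)%E /\
      forall w, G w ->
        forall h : Rd d -> R, is_ltf h ->
          bag_err k h (fun i j => X i j w) <= eps ->
          (k%:R != q%:R / 2 :> R ->
             disagree D (ltf r0 c0) h <= 4 * eps) /\
          (k%:R = q%:R / 2 :> R ->
             disagree D (ltf r0 c0) h <= 4 * eps \/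
             disagree D (ltf r0 c0) (fun x => 1 - h x) <= 4 * eps).
Proof.
exists 100; split; first by rewrite ltr0n.
move=> d D r0 c0 q k m eps delta dO O P X q2 kq D1 D0 e0 eq4 de0 hm XP.
(* For [delta >= 1] the empty event suffices; below 1, [ln (1 / delta)] is positive. *)
have [de1|de1] := leP 1 delta.
  exists set0; split; first exact: measurable0.
  by split=> //; rewrite measure0 lee_fin subr_le0.
have side_gt0 b : 0 < pr D (side r0 c0 b).
  rewrite -lte_fin -prK; last exact: measurable_side.
  by rewrite -ltf_side; case: b.
(* In dimension 0 every threshold function is constant, so the two sides could not both have
   positive probability. *)
have d1 : (1 <= d)%N.
  rewrite lt0n; apply/eqP => d0; subst d.
  have [x1 hx1] : side r0 c0 true !=set0.
    by apply/set0P/eqP => s0; have := side_gt0 true; rewrite s0 pr0 ltxx.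
  have [x2 hx2] : side r0 c0 false !=set0.
    by apply/set0P/eqP => s0; have := side_gt0 false; rewrite s0 pr0 ltxx.
  by move: hx1 hx2; rewrite /side /= /label /score !big_ord0 => ->.
have [em3 small] : 3 <= eps * m%:R /\ _ :=
  sample_size_bound d1 q2 e0 eq4 (introT andP (conj de0 (ltW de1))) hm.
have qR : 2 <= q%:R :> R by rewrite (ler_nat _ 2).
have eq1 : eps * (4 * q%:R) < 1 by rewrite -ltr_pdivlMr//; lra.
have e2 : 4 * eps < 1 / 2 by nra.
have t01 : 0 < eps / (32 * q%:R) <= 1.
  by rewrite divr_gt0 ?ler_pdivrMr//=; nra.
have m0 : (0 < m)%N by case: (m) em3 => //; rewrite mulr0; lra.
pose bad (n : nat) w := ~ accurate D (ltf r0 c0)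
    (ltf (rational_halfspace R d n).1 (rational_halfspace R d n).2) q k eps /\
  (bag_misses k (@rational_label R d n) (fun i j => X i j w))%:R <= eps * m%:R.
(* These events increase with [N] while their bound [delta] does not depend on [N], so it passes to
   the union by continuity from below. *)
pose B N := [set w | exists2 n : nat, (n < N)%N & bad n w].
have BE N : B N = fooled_samples D r0 c0 k N eps X.
  apply/seteqP; split=> w [].
    by move=> n nN [h1 h2]; exists (Ordinal nN).
  by move=> n h1 h2; exists n.
have mB N : measurable (B N) by rewrite BE; exact: measurable_fooled_samples XP.
have leB N : pr P (B N) <= delta.
  by rewrite BE; apply: le_trans small; exact: pr_fooled_samples.
have mU : measurable (\bigcup_N B N) by exact: bigcup_measurable.
exists (~` \bigcup_N B N); split; first exact: measurableC.
split.
  rewrite probability_setC// prK// -EFinB lee_fin lerD2l lerN2.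
  apply: pr_bigcup_le => // i j ij w [n ni bn]; exists n => //.
  exact: leq_trans ij.
move=> w Gw h [r [c hE]].
have {hE} -> : h = ltf r c by apply/funext.
move=> /(bag_err_misses (ltnW q2) m0) err.
(* An inaccurate [h] with small sample error has a rational neighbour that is still inaccurate and
   labels the whole sample identically, so [w] would lie in the excluded union. *)
apply: contrapT => /inaccurate_near[eta eta0 nacc].
have [n [nX nD]] := rational_label_approx D r c (fun p : 'I_m * 'I_q => X p.1 p.2 w) eta0.
apply: Gw; exists n.+1 => //; exists n => //; split; first exact: nacc.
rewrite (_ : bag_misses _ _ _ = bag_misses k (label r c) (fun i j => X i j w))//.
apply: eq_bigr => i _; congr (nat_of_bool (_ != _)); apply: eq_bigr => j _.
by rewrite (nX (i, j)).
Qed.
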